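(* Let $n$ be a positive integer. Define a double-indexed sequence $T_r(k)$ (integers $r\ge 0$, $k\ge 0$) by $T_r(0)=1$ for all $r$ and, for $k\ge 1$, $$T_r(k)=4\,(n-r-k)\,T_r(k-1)-2\,(n-2r-\delta(n-1))\,T_{r+1}(k-1).$$ Then $$\frac{T_0(\lfloor n/2\rfloor)}{(n-1)(n-2)\cdots(n-\lfloor n/2\rfloor)}=2^{\delta(n-1)}.$$
   Context: For an integer $m\ge 0$, $\delta(m)\in\{0,1\}$ is the residue of $m$ modulo $2$. The denominator is $\prod_{j=1}^{\lfloor n/2\rfloor}(n-j)$; an empty product equals $1$. *)

(* Defs.v *)
From mathcomp Require Import all_boot all_order all_algebra.
Set Implicit Arguments.
Unset Strict Implicit.
Unset Printing Implicit Defensive.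
Import Order.TTheory GRing.Theory Num.Theory.
Local Open Scope ring_scope.

Definition delta (m : nat) : nat := (m %% 2)%N.

(* [T n r k] is T_r(k) for the parameter n. The factors n - r - k and
   n - 2r - delta(n-1) can be negative, so they are formed in int. *)
Fixpoint T (n r k : nat) {struct k} : int :=
  if k is k'.+1 then
    4 * (n%:Z - r%:Z - k%:Z) * T n r k'
    - 2 * (n%:Z - 2 * r%:Z - (delta n.-1)%:Z) * T n r.+1 k'
  else 1.

(* Main.v *)
Require Import Defs.
From mathcomp Require Import all_boot all_order all_algebra.
From mathcomp Require Import ring zify.
Set Implicit Arguments.
Unset Strict Implicit.
Unset Printing Implicit Defensive.
Import Order.TTheory GRing.Theory Num.Theory.
Local Open Scope ring_scope.

(** The recursion looks two-dimensional, but [T n r k] does not depend on [r]: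
    once the two values [T n r k'] and [T n r.+1 k'] agree, their coefficients
    add up to [2 * (n + delta n.-1 - 2 * k)], in which [r] cancels. Hence
    [T n r k] is a product of such factors ([T_prod]).

    Put [m = n %/ 2]. For either parity of [n], [n + delta n.-1 = 2 * m + 1]
    ([add_delta_pred]), so [T n 0 m] is [2 ^ m] times the product of the odd
    numbers below [2 * m], which is [(2 * m)! / m!] ([prod_double_odd_fact]).
    The denominator is the falling factorial of [n - 1] with [m] terms.
    Multiplied by [m!], it gives [(2 * m)!] when [n] is odd, and half of that
    when [n] is even, because then its factor [n] is lacking and the factor [m]
    is present instead ([ffact_pred_half]). *)

Lemma T_prod (n r k : nat) :
  T n r k = \prod_(1 <= j < k.+1) (2 * ((n + delta n.-1)%:Z - 2 * j%:Z)).
Proof.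
elim: k r => [|k IHk] r; first by rewrite big_geq.
by rewrite big_nat_recr //= !IHk; ring.
Qed.

Lemma add_delta_pred (n : nat) :
  (0 < n)%N -> (n + delta n.-1 = (n %/ 2).*2.+1)%N.
Proof. by rewrite /delta; lia. Qed.

Lemma prod_double_odd_fact (m : nat) :
  ((\prod_(0 <= i < m) (2 * i.*2.+1)) * m`! = (m.*2)`!)%N.
Proof.
elim: m => [|m IHm]; first by rewrite big_geq.
by rewrite big_nat_recr //= doubleS !factS -IHm -(mul2n m); ring.
Qed.

(** Each factor of the numerator is odd up to the factor 2; reading the product
    backwards turns [2 * m + 1 - 2 * j] into [2 * i + 1]. *)
Lemma T_half (n r : nat) : (0 < n)%N ->
  T n r (n %/ 2) = (\prod_(0 <= i < n %/ 2) (2 * i.*2.+1))%N%:Z.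
Proof.
move=> n_gt0; rewrite T_prod add_delta_pred //; set m := (n %/ 2)%N.
rewrite big_add1 big_nat_rev /= -[RHS]natz natr_prod; apply: eq_big_nat => i lt_im.
by rewrite natz; lia.
Qed.

Lemma prod_subr_ffact (n m : nat) : (m < n)%N ->
  \prod_(1 <= j < m.+1) (n%:R - j%:R) = (n.-1 ^_ m)%:R :> rat.
Proof.
move=> lt_mn; rewrite ffact_prod natr_prod big_add1 big_mkord.
apply: eq_bigr => i _; rewrite -natrB; last by have := ltn_ord i; lia.
by rewrite -(subn1 n) -subnDA add1n.
Qed.

Lemma ffact_pred_half (n : nat) : (0 < n)%N ->
  (2 ^ delta n.-1 * n.-1 ^_ (n %/ 2) * (n %/ 2)`! = ((n %/ 2).*2)`!)%N.
Proof.
move=> n_gt0; have := add_delta_pred n_gt0; set m := (n %/ 2)%N.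
have: (delta n.-1 < 2)%N by rewrite ltn_mod.
case: (delta n.-1) => [|[|//]] _ def_n.
  have -> : n.-1 = m.*2 by lia.
  have le_m2m : (m <= m.*2)%N by lia.
  by rewrite -(ffact_fact le_m2m) -addnn addnK mul1n.
have m_gt0 : (0 < m)%N by lia.
have -> : n.-1 = m.*2.-1 by lia.
case: m m_gt0 {def_n} => // m _; rewrite doubleS /= !factS.
have le_m : (m.+1 <= m.*2.+1)%N by lia.
have -> : (m.*2.+1 * (m.*2)`! = (m.*2.+1)`!)%N by rewrite factS.
rewrite -(ffact_fact le_m).
have -> : (m.*2.+1 - m.+1 = m)%N by lia.
by rewrite -(mul2n m); ring.
Qed.

Theorem theorem6 (n : nat) (n_gt0 : (0 < n)%N) :
  (T n 0 (n %/ 2))%:~R / \prod_(1 <= j < (n %/ 2).+1) (n%:R - j%:R)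
  = 2 ^+ delta n.-1 :> rat.
Proof.
have lt_mn : (n %/ 2 < n)%N by rewrite ltn_Pdiv.
rewrite T_half // prod_subr_ffact //.
have ffact_neq0 : (n.-1 ^_ (n %/ 2))%:R != 0 :> rat.
  by rewrite pnatr_eq0 -lt0n ffact_gt0; lia.
apply: (canLR (mulfK ffact_neq0)).
rewrite pmulrn -natrX -natrM; congr (_%:R).
apply/eqP; rewrite -(eqn_pmul2r (fact_gt0 (n %/ 2))); apply/eqP.
by rewrite prod_double_odd_fact ffact_pred_half.
Qed.
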